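(* Let $G=\mathbb Z\rtimes\mathbb Z$, where the second factor acts non-trivially on the first; that is, $G=\langle x,y\mid xyxy^{-1}=1\rangle$ is the fundamental group of the Klein bottle. Then for every automorphism $\varphi$ of $G$ we have $R(\varphi)=\infty$.
   Context: For an endomorphism $\varphi:G\to G$ of a group, $G$ acts on itself by $\sigma\cdot\alpha=\sigma\alpha\varphi(\sigma)^{-1}$. The orbits are called $\varphi$-twisted conjugacy classes, and the Reidemeister number $R(\varphi)$ is the number of orbits ($\infty$ if there are infinitely many). *)

(* Defs.v *)
From HB Require Import structures.
From mathcomp Require Import all_boot all_order all_algebra.
From mathcomp Require Import finmap.
From mathcomp Require Import boolp classical_sets cardinality constructive_ereal.

Set Implicit Arguments.
Unset Strict Implicit.
Unset Printing Implicit Defensive.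

Import Algebra GRing.Theory.

Local Open Scope classical_set_scope.
Local Open Scope group_scope.

(* For groups, preservation of products and of 1 is all that a morphism needs,
   and a group automorphism is a bijective endomorphism. *)
Notation group_hom G H := (UMagmaMorphism.type G H).

Section Reidemeister.
Variables (G : groupType) (phi : group_hom G G).

Definition twisted_act (s a : G) : G := s * a * (phi s)^-1.

Definition twisted_class (a : G) : set G := range (twisted_act ^~ a).

Definition twisted_classes : set (set G) := range twisted_class.

Definition Reidemeister : \bar nat :=
  if `[< finite_set twisted_classes >] then (#|` fset_set twisted_classes |)%:E
  else +oo%E.

Lemma twisted_act1 a : twisted_act 1 a = a.
Proof. by rewrite /twisted_act gmulf1 invg1 mul1g mulg1. Qed.

Lemma twisted_actM s t a :
  twisted_act (s * t) a = twisted_act s (twisted_act t a).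
Proof. by rewrite /twisted_act gmulfM invgM !mulgA. Qed.

End Reidemeister.

(* A homomorphism from H to Aut(N), in uncurried form; invertibility of each
   [theta h] follows from [gaut1] and [gautM]. *)
Record group_action (H N : groupType) := GroupAction {
  gaut :> H -> N -> N;
  gaut1 : forall n, gaut 1 n = n;
  gautM : forall h k n, gaut (h * k) n = gaut h (gaut k n);
  gaut_morph : forall h, {morph gaut h : m n / m * n}
}.

Definition nontrivial_action (H N : groupType) (theta : group_action H N) :=
  exists h n, theta h n <> n.

Record semidirect (H N : groupType) (theta : group_action H N) :=
  Semidirect { sdN : N; sdH : H }.

Section SemidirectGroup.
Variables (H N : groupType) (theta : group_action H N).
Local Notation S := (semidirect theta).

Definition sd_pair (u : S) := (sdN u, sdH u).
Definition pair_sd (p : N * H) : S := Semidirect theta p.1 p.2.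
Lemma sd_pairK : cancel sd_pair pair_sd. Proof. by case. Qed.

HB.instance Definition _ := Choice.copy S (can_type sd_pairK).

Definition sd_one : S := Semidirect theta 1 1.
Definition sd_mul (u v : S) : S :=
  Semidirect theta (sdN u * theta (sdH u) (sdN v)) (sdH u * sdH v).
Definition sd_inv (u : S) : S :=
  Semidirect theta (theta (sdH u)^-1 (sdN u)^-1) (sdH u)^-1.

Lemma gaut_1 h : theta h 1 = 1.
Proof.
by apply: (@mulgI _ (theta h 1)); rewrite -gaut_morph !mulg1.
Qed.

Lemma sd_mulA : associative sd_mul.
Proof.
by move=> [a g] [b h] [c k]; rewrite /sd_mul /= gaut_morph gautM !mulgA.
Qed.
Lemma sd_mul1 : left_id sd_one sd_mul.
Proof. by move=> [a g]; rewrite /sd_mul /= gaut1 !mul1g. Qed.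
Lemma sd_1mul : right_id sd_one sd_mul.
Proof. by move=> [a g]; rewrite /sd_mul /= gaut_1 !mulg1. Qed.
Lemma sd_mulV : left_inverse sd_one sd_inv sd_mul.
Proof.
by move=> [a g]; rewrite /sd_mul /sd_one /= -gaut_morph !mulVg gaut_1.
Qed.
Lemma sd_Vmul : right_inverse sd_one sd_inv sd_mul.
Proof.
by move=> [a g]; rewrite /sd_mul /sd_one /= -gautM !mulgV gaut1 mulgV.
Qed.

HB.instance Definition _ :=
  isGroup.Build S sd_mulA sd_mul1 sd_1mul sd_mulV sd_Vmul.

Lemma sd_mulE n h m k : Semidirect theta n h * Semidirect theta m k =
  Semidirect theta (n * theta h m) (h * k).
Proof. by []. Qed.

Lemma sd_invE n h :
  (Semidirect theta n h)^-1 = Semidirect theta (theta h^-1 n^-1) h^-1.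
Proof. by []. Qed.

End SemidirectGroup.

(* The infinite cyclic group: the additive group of [int], with its operation
   written multiplicatively. *)
Notation ZZ := (to_multiplicative int).

(* [klein_presented x y] : the group is < x, y | x y x y^-1 = 1 >, expressed by
   the universal property of the presentation. *)
Definition klein_presented (G : groupType) (x y : G) : Prop :=
  x * y * x * y^-1 = 1 /\
  forall (K : groupType) (a b : K), a * b * a * b^-1 = 1 ->
    exists f : group_hom G K, (f x = a /\ f y = b) /\
      forall g : group_hom G K, g x = a -> g y = b -> g =1 f.

Section Klein.

Let z1 : ZZ := 1%R : int.

Lemma int_step_ind (P : int -> Prop) :
  P 0%R -> (forall n, P n -> P (n + 1)%R) -> (forall n, P n -> P (n - 1)%R) ->
  forall n, P n.
Proof.
move=> P0 PS PB; elim/int_ind => [//|n IHn|n IHn].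
  by rewrite intS addrC; apply: PS.
by rewrite intS addrC opprD; apply: PB.
Qed.

Lemma ZZ_ind (P : ZZ -> Prop) :
  P z1 -> (forall m n, P m -> P n -> P (m * n)) -> (forall n, P n -> P n^-1) ->
  forall n, P n.
Proof.
move=> P1 PM PV.
have P0 : P 1 by rewrite -(mulgV z1); apply: PM => //; apply: PV.
elim/int_step_ind => [//|n IHn|n IHn]; first exact: PM.
exact: (PM n (z1^-1) IHn (PV _ P1)).
Qed.

Section Pow.
Variables (K : groupType) (a : K).

Definition zpow (n : ZZ) : K :=
  match n with Posz k => a ^+ k | Negz k => a ^- k.+1 end.

Lemma zpowS (n : int) : zpow (n + 1)%R = zpow n * a.
Proof.
case: n => [n|[|n]].
- by rewrite /= addn1 expgSr.
- by rewrite /= expg1 mulVg.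
- have ->: (Negz n.+1 + 1)%R = Negz n.
    by rewrite NegzE (intS n.+1) opprD addrAC addNr add0r NegzE.
  by rewrite /= (expgS a n.+1) invgM mulgVK.
Qed.

Lemma zpowB (n : int) : zpow (n - 1)%R = zpow n * a^-1.
Proof. by rewrite -[n in RHS](subrK 1%R) zpowS mulgK. Qed.

Lemma zpowM : {morph zpow : m n / m * n}.
Proof.
move=> m n; change (zpow (m + n : int)%R = zpow m * zpow n).
elim/int_step_ind: n => [|n IHn|n IHn].
- by rewrite addr0 mulg1.
- by rewrite addrA !zpowS IHn mulgA.
- by rewrite addrA !zpowB IHn mulgA.
Qed.

Lemma zpow1 : zpow 1 = 1. Proof. by []. Qed.

HB.instance Definition _ := isUMagmaMorphism.Build ZZ K zpow (zpow1, zpowM).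
End Pow.

Variable theta : group_action ZZ ZZ.
Hypothesis theta_nt : nontrivial_action theta.

HB.instance Definition _ h :=
  isUMagmaMorphism.Build ZZ ZZ (theta h) (gaut_1 theta h, @gaut_morph _ _ theta h).

Lemma thetaE h (n : int) : theta h n = (n * (theta h z1 : int))%R.
Proof.
elim/int_step_ind: n => [|n IHn|n IHn].
- by rewrite mul0r; exact: gaut_1.
- by rewrite mulrDl mul1r -IHn; exact: (gaut_morph theta h n z1).
- transitivity (theta h n * theta h z1^-1); first exact: gaut_morph.
  by rewrite gmulfV mulrDl mulN1r -IHn.
Qed.

Lemma theta11 : theta z1 z1 = z1^-1.
Proof.
have E : ((theta (z1^-1)%g z1 : int) * (theta z1 z1 : int) = 1)%R.
  by rewrite -thetaE -gautM mulgV gaut1.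
have [h [n ne]] := theta_nt.
have /orP[/eqP e1|/eqP->//] : (eq_op (theta z1 z1 : int) 1%R) ||
    (eq_op (theta z1 z1 : int) (-1)%R) by exact: (intUnitRing.unitzPl E).
case: ne; move: n; have e1' : theta z1 z1 = z1 by exact: e1.
have e2 m : theta z1 m = m by rewrite thetaE e1' mulr1.
elim/ZZ_ind: h => [//|h k Hh Hk|h Hh] m.
  by rewrite gautM Hk Hh.
by rewrite -[in LHS](Hh m) -gautM mulVg gaut1.
Qed.

Lemma zpow_theta (K : groupType) (a b : K) : a * b * a * b^-1 = 1 ->
  forall h m, zpow b h * zpow a m = zpow a (theta h m) * zpow b h.
Proof.
move=> rel; have ba : b * a = a^-1 * b.
  by apply: (mulgI a); apply: (mulIg b^-1); rewrite !mulgA rel mulgV mul1g mulgV.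
elim/ZZ_ind => [|h k Hh Hk|h Hh] m.
- elim/ZZ_ind: m => [|m n Hm Hn|m Hm].
  + by rewrite theta11 gmulfV /= !expg1.
  + by rewrite gaut_morph !gmulfM mulgA Hm -mulgA Hn mulgA.
  + rewrite !gmulfV; apply: (mulgI (zpow a (theta z1 m))).
    by rewrite mulgA -Hm mulgK mulgA mulgV mul1g.
- by rewrite gautM !gmulfM -mulgA Hk mulgA Hh mulgA.
- rewrite gmulfV; apply: (mulgI (zpow b h)); rewrite mulgA mulgV mul1g.
  by rewrite mulgA Hh -gautM mulgV gaut1 mulgK.
Qed.

Lemma semidirect_klein_presented :
  klein_presented (Semidirect theta z1 1) (Semidirect theta 1 z1).
Proof.
split=> [|K a b rel].
  by rewrite sd_invE invg1 !sd_mulE !gaut_1 !mulg1 mul1g theta11 !mulgV.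
pose f (u : semidirect theta) := zpow a (sdN u) * zpow b (sdH u).
have fM : monoid.monoid_morphism f.
  split=> [|[n h] [m k]]; first by rewrite /f /= mulg1.
  have -> : f (Semidirect theta n h * Semidirect theta m k) =
      zpow a n * zpow a (theta h m) * (zpow b h * zpow b k).
    by rewrite sd_mulE /f /sdN /sdH !gmulfM.
  by rewrite /f /= -mulgA [zpow a (theta h m) * _]mulgA -(zpow_theta rel) !mulgA.
pose F : group_hom (semidirect theta) K := HB.pack f (isUMagmaMorphism.Build _ _ f fM).
exists F; split; first by split; rewrite /= /f /= ?mulg1 ?mul1g.
move=> g gx gy [n h].
have gN m : g (Semidirect theta m 1) = zpow a m.
  elim/ZZ_ind: m => [|m m' Hm Hm'|m Hm]; first by rewrite gx.
    have ->: Semidirect theta (m * m') 1 =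
       Semidirect theta m 1 * Semidirect theta m' 1.
      by rewrite sd_mulE gaut1 mulg1.
    by rewrite !gmulfM Hm Hm'.
  have ->: Semidirect theta m^-1 1 = (Semidirect theta m 1)^-1.
    by rewrite sd_invE invg1 gaut1.
  by rewrite !gmulfV Hm.
have gH m : g (Semidirect theta 1 m) = zpow b m.
  elim/ZZ_ind: m => [|m m' Hm Hm'|m Hm]; first by rewrite gy.
    have ->: Semidirect theta 1 (m * m') =
       Semidirect theta 1 m * Semidirect theta 1 m'.
      by rewrite sd_mulE gaut_1 mulg1.
    by rewrite !gmulfM Hm Hm'.
  have ->: Semidirect theta 1 m^-1 = (Semidirect theta 1 m)^-1.
    by rewrite sd_invE invg1 gaut_1.
  by rewrite !gmulfV Hm.
have e : Semidirect theta n h = Semidirect theta n 1 * Semidirect theta 1 h.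
  by rewrite sd_mulE gaut1 mulg1 mul1g.
by rewrite [in LHS]e gmulfM gN gH.
Qed.

End Klein.

(* Main.v *)
(** An automorphism of the semidirect product restricts to [s |-> e s] on the
    normal factor and induces [k |-> d k] on the quotient, with [e] and [d] equal
    to 1 or -1.  If [d = 1], the quotient coordinate is a twisted conjugacy
    invariant.  If [d = -1], two elements [(m, h)] and [(n, h)] can only be twisted
    conjugate through some [(s, 0)], which sends [(n, h)] to
    [(s + n - (-1)^h e s, h)]; hence the [(n, 0)] are pairwise inequivalent when
    [e = 1], and so are the [(n, 1)] when [e = -1]. *)

Require Import Defs.
From mathcomp Require Import all_boot all_order all_algebra.
From mathcomp Require Import boolp.
From mathcomp Require Import classical_sets cardinality constructive_ereal.
From mathcomp Require Import zify.

Set Implicit Arguments.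
Unset Strict Implicit.
Unset Printing Implicit Defensive.

Import GRing.Theory.

Local Open Scope classical_set_scope.
Local Open Scope group_scope.

Section TwistedClasses.
Variables (G : groupType) (phi : group_hom G G).

Lemma twisted_class_act (a b : G) :
  twisted_class phi a = twisted_class phi b -> exists s, twisted_act phi s b = a.
Proof.
move=> ab; have : twisted_class phi a a by exists 1; rewrite ?twisted_act1.
by rewrite ab => -[s _ sb]; exists s.
Qed.

(** Restricted to [nat], [f] gives pairwise distinct classes; were there finitely many, their
    preimage under this injection, all of [nat], would be finite. *)
Lemma Reidemeister_infty (f : int -> G) :
  (forall m n s, twisted_act phi s (f n) = f m -> m = n) ->
  Reidemeister phi = +oo%E.
Proof.
move=> f_inj; rewrite /Reidemeister; case: asboolP => // fin.
pose c (n : nat) := twisted_class phi (f n).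
case: infinite_nat; rewrite (_ : setT = c @^-1` twisted_classes phi).
  apply: finite_preimage fin => m n _ _ /twisted_class_act[s /f_inj].
  by case.
by apply/seteqP; split=> // n _; exists (f n).
Qed.

End TwistedClasses.

Lemma ZZ_homE (f : ZZ -> ZZ) : {morph f : m n / m * n} ->
  forall n : int, f n = (n * (f (1%R : int) : int))%R.
Proof.
move=> fM.
have fD (m n : int) : f (m + n)%R = (f m + f n)%R :> (int) := fM m n.
have f0 : f (0%R : int) = 0%R :> (int) by have := fD 0%R 0%R; rewrite addr0; lia.
elim/int_step_ind => [|n IHn|n IHn]; first by rewrite mul0r.
- by rewrite fD IHn mulrDl mul1r.
- have := fD (n - 1)%R 1%R; rewrite subrK IHn mulrBl mul1r => ->.
  by rewrite addrK.
Qed.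

Lemma mulz_eq1 (a b : int) : (a * b = 1)%R -> a = 1%R \/ a = (-1)%R.
Proof.
move=> ab; have ba : (b * a = 1)%R by rewrite mulrC.
by have /orP[/eqP|/eqP] := intUnitRing.unitzPl ba; [left|right].
Qed.

Section KleinAutomorphism.
Variables (theta : group_action ZZ ZZ) (theta_nt : nontrivial_action theta).
Variable phi : group_hom (semidirect theta) (semidirect theta).
Hypothesis phi_aut : bijective phi.

Local Notation S := (Semidirect theta).
Local Notation z1 := (1%R : int).

Lemma action_gen (n : int) : theta z1 n = (- n)%R :> (int).
Proof.
have -> := ZZ_homE (@gaut_morph _ _ theta z1) n.
have -> : theta z1 z1 = (-1)%R :> (int) := theta11 theta_nt.
by rewrite mulrN1.
Qed.

Lemma sd_fiberM (m n : ZZ) : S (m * n) 1 = S m 1 * S n 1.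
Proof. by rewrite sd_mulE gaut1 mulg1. Qed.

Lemma sd_split (n h : ZZ) : S n h = S n 1 * S 1 h.
Proof. by rewrite sd_mulE gaut1 mulg1 mul1g. Qed.

(** Conjugation by [S 1 z1] inverts [S s 1], whereas the quotient is abelian; so the image equals
    its own opposite, and the integers have no 2-torsion. *)
Lemma sdH_phi_fiber (s : ZZ) : sdH (phi (S s 1)) = 1.
Proof.
have conj : S (theta z1 s) 1 * S 1 z1 = S 1 z1 * S s 1.
  by rewrite !sd_mulE gaut1 !mulg1 !mul1g.
have gM : {morph (fun s => sdH (phi (S s 1))) : m n / m * n}.
  by move=> m n; rewrite sd_fiberM gmulfM.
have := congr1 (fun u => sdH (phi u)) conj.
rewrite !gmulfM /=.
have gE := ZZ_homE gM; have -> := gE (theta z1 s); have -> := gE s.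
rewrite action_gen; set g := sdH (phi (S z1 1)); set d := sdH _.
(* Products in [ZZ] are sums in [int] by conversion; the additive form is what [lia] can read. *)
change ((- (s : int) * (g : int) + (d : int) = (d : int) + (s : int) * (g : int))%R
  -> ((s : int) * (g : int) = 0)%R).
by lia.
Qed.

Lemma sdH_phi (u : semidirect theta) :
  sdH (phi u) = ((sdH u : int) * (sdH (phi (S 1 z1)) : int))%R.
Proof.
have dM : {morph (fun k => sdH (phi (S 1 k))) : m n / m * n}.
  move=> m n; have -> : S 1 (m * n) = S 1 m * S 1 n.
    by rewrite sd_mulE gaut_1 mulg1.
  by rewrite gmulfM.
case: u => n h; rewrite sd_split gmulfM.
transitivity (sdH (phi (S n 1)) * sdH (phi (S 1 h))) => //.
by rewrite sdH_phi_fiber mul1g; have -> := ZZ_homE dM h; rewrite /= mul1g.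
Qed.

(** The images have trivial quotient coordinate, so the action does not twist their products and
    [sdN] is additive on them. *)
Lemma phi_fiber (s : int) :
  phi (S s 1) = S (s * (sdN (phi (S z1 1)) : int))%R 1.
Proof.
have fM : {morph (fun s => sdN (phi (S s 1))) : m n / m * n}.
  by move=> m n; rewrite sd_fiberM gmulfM /= sdH_phi_fiber gaut1.
rewrite -(ZZ_homE fM).
by have := sdH_phi_fiber s; case: (phi _) => n h /= ->.
Qed.

(** A preimage of [S 1 z1] has a quotient coordinate whose product with this integer is 1. *)
Lemma sdH_phi_gen :
  sdH (phi (S 1 z1)) = 1%R :> (int) \/ sdH (phi (S 1 z1)) = (-1)%R :> (int).
Proof.
have [psi _ psiK] := phi_aut.
have := sdH_phi (psi (S 1 z1)); rewrite psiK /= mulrC => /esym.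
exact: mulz_eq1.
Qed.

(** A preimage of [S z1 1] has quotient coordinate 0, because [phi] only changes that coordinate by
    a sign; it thus lies in the normal factor, where [phi_fiber] makes this integer a unit. *)
Lemma sdN_phi_gen :
  sdN (phi (S z1 1)) = 1%R :> (int) \/ sdN (phi (S z1 1)) = (-1)%R :> (int).
Proof.
have [psi _ psiK] := phi_aut.
have := psiK (S z1 1); case: (psi _) => t k phi_tk.
have k0 : k = 1.
  have := sdH_phi (S t k); rewrite phi_tk /=.
  change (0%R = ((k : int) * (sdH (phi (S 1 z1)) : int))%R -> k = 0%R :> (int)).
  by case: sdH_phi_gen => ->; lia.
move: phi_tk; rewrite k0 phi_fiber => -[]; rewrite mulrC; exact: mulz_eq1.
Qed.

Lemma sdH_twisted_act (s a : semidirect theta) :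
  sdH (twisted_act phi s a) =
  ((sdH s : int) + (sdH a : int) - (sdH s : int) * (sdH (phi (S 1 z1)) : int))%R.
Proof. by rewrite -sdH_phi. Qed.

Lemma twisted_act_fiber (s n : int) (h : ZZ) :
  twisted_act phi (S s 1) (S n h) =
  S (((s + n)%R : ZZ) * theta h (- (s * (sdN (phi (S z1 1)) : int)))%R) h.
Proof.
by rewrite /twisted_act (phi_fiber s) sd_invE !sd_mulE invg1 !gaut1 mulg1 mul1g.
Qed.

End KleinAutomorphism.

Theorem theorem2p2 (theta : group_action ZZ ZZ)
    (theta_nt : nontrivial_action theta)
    (phi : group_hom (semidirect theta) (semidirect theta))
    (phi_aut : bijective phi) :
  Reidemeister phi = +oo%E.
Proof.
have [d1|dN1] := sdH_phi_gen theta_nt phi_aut.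
  apply: (@Reidemeister_infty _ _ (fun n => Semidirect theta 1 n)) => m n s.
  by move=> /(congr1 (@sdH _ _ _)); rewrite (sdH_twisted_act theta_nt) d1 /=; lia.
have sdH_conj s m n h :
    twisted_act phi s (Semidirect theta n h) = Semidirect theta m h ->
    s = Semidirect theta (sdN s) 1.
  move=> /(congr1 (@sdH _ _ _)); rewrite (sdH_twisted_act theta_nt) dN1 /=.
  (* Here [hk] says k + h + k = h. *)
  case: s => t k /= hk; congr Semidirect; change (k = 0%R :> (int)); lia.
have [e1|eN1] := sdN_phi_gen theta_nt phi_aut.
  apply: (@Reidemeister_infty _ _ (fun n => Semidirect theta n 1)) => m n s act_s.
  have Es := sdH_conj _ _ _ _ act_s; move: act_s.
  rewrite Es (twisted_act_fiber theta_nt) e1 gaut1 => -[].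
  set t := sdN s; change (((t : int) + n + - ((t : int) * 1))%R = m -> m = n).
  by lia.
(* Over 0 the shift would be n + 2s, leaving only the parity of n invariant; over 1 the sign of the
   action cancels that of [eN1]. *)
apply: (@Reidemeister_infty _ _ (fun n => Semidirect theta n (1%R : int))).
move=> m n s act_s.
have Es := sdH_conj _ _ _ _ act_s; move: act_s.
rewrite Es (twisted_act_fiber theta_nt) eN1 (action_gen theta_nt) => -[].
set t := sdN s; change (((t : int) + n + - - ((t : int) * -1))%R = m -> m = n).
by lia.
Qed.
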